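(* Let $G$ be a non-bipartite distance-regular graph with valency $k$, diameter $D\geq 3$ and $\mu > k/2$. Then $\lambda\geq 1$ and $G$ is $t$-extendable, where $t=\lfloor k/3 \rfloor$.
   Context: All graphs are finite, simple and undirected. A connected graph $G$ of diameter $D$ is distance-regular if there are integers $b_0,\dots,b_{D-1},c_1,\dots,c_D$ such that for all vertices $x,y$ at distance $i$, the vertex $y$ has exactly $c_i$ neighbors at distance $i-1$ from $x$ (for $1\le i\le D$) and exactly $b_i$ neighbors at distance $i+1$ from $x$ (for $0\le i\le D-1$). Such a graph is regular of valency $k=b_0$. $\lambda$ is the number of common neighbors of any two adjacent vertices, and $\mu=c_2$ is the number of common neighbors of any two vertices at distance $2$. A matching is a set of edges no two of which share a vertex; it is perfect if every vertex is incident with one of its edges. A connected graph of even order $v$ is called $t$-extendable if it contains a perfect matching, $t<v/2$, and every matching of $t$ edges is contained in some perfect matching. *)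

(* Defs.v *)
From mathcomp Require Import all_boot.

Set Implicit Arguments.
Unset Strict Implicit.
Unset Printing Implicit Defensive.

(* A finite simple graph is a symmetric irreflexive relation [e] on a finType;
   symmetry and irreflexivity are not bundled into the definitions below. *)

Section Graph.

Variables (T : finType) (e : rel T).

Definition connected_graph : Prop := forall x y : T, connect e x y.

Definition bipartite : Prop :=
  exists A : {set T}, forall x y : T, e x y -> (x \in A) != (y \in A).

Definition walk_of_length (n : nat) (x y : T) : bool :=
  [exists p : n.-tuple T, path e x p && (last x p == y)].

(* A shortest walk repeats no vertex, so lengths below [#|T|] suffice;
   the value is [#|T|] when [y] is not reachable from [x]. *)
Definition gdist (x y : T) : nat :=
  find (fun n => walk_of_length n x y) (iota 0 #|T|).

Definition diameter : nat := \max_(x : T) \max_(y : T) gdist x y.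

(* Only [b 0, ..., b (D - 1)] and [c 1, ..., c D] are constrained,
   where [D] is the diameter. *)
Definition intersection_numbers (b c : nat -> nat) : Prop :=
  forall (i : nat) (x y : T), gdist x y = i ->
    (1 <= i <= diameter ->
       #|[set z | e y z & gdist x z == i - 1]| = c i) /\
    (i < diameter ->
       #|[set z | e y z & gdist x z == i + 1]| = b i).

Definition distance_regular (b c : nat -> nat) : Prop :=
  connected_graph /\ intersection_numbers b c.

Definition common_neighbors (x y : T) : {set T} := [set z | e x z & e y z].

Definition is_lambda (lambda : nat) : Prop :=
  forall x y : T, e x y -> #|common_neighbors x y| = lambda.

Definition edges : {set {set T}} :=
  [set [set xy.1; xy.2] | xy : T * T & e xy.1 xy.2].

Definition matching (M : {set {set T}}) : Prop :=
  M \subset edges /\ trivIset M.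

Definition perfect_matching (M : {set {set T}}) : Prop :=
  matching M /\ cover M = [set: T].

Definition extendable (t : nat) : Prop :=
  [/\ connected_graph,
      ~~ odd #|T|,
      exists M, perfect_matching M,
      2 * t < #|T|
    & forall M, matching M -> #|M| = t ->
        exists2 N, perfect_matching N & M \subset N].

End Graph.

(* Main.v *)
Require Import Defs.
From mathcomp Require Import all_boot.
From mathcomp Require Import all_order all_algebra all_field.
From mathcomp Require Import zify ring.

(** Distances are rigid under the hypotheses. Two subsets of a neighbourhood of
    more than half its size meet; hence two consecutive steps of length 2 never
    lead to distance 3 or more ([d2_trans]). From this the diameter is 3, and a
    non-bipartite graph is an antipodal double cover of a complete graph (a
    Taylor graph): each [x] has a single vertex [antipode x] at distance 3, and
    any other vertex is adjacent to exactly one of the two ([antipode_unique],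
    [antipode_adj]). In particular [k = 1 + lambda + mu], the order is
    [2 (k + 1)], and [lambda > 0] since otherwise the graph is bipartite.

    In such a cover [lambda] and [mu] are even, so [k] is odd. A trace argument
    shows that the second largest eigenvalue is an integer; it is a divisor of
    [k] other than 1, hence at least 3 ([eigenvalue_bound]). Therefore an
    independent set without antipodal vertices has at most [k / 3 + 1] elements
    ([independent_set_bound]).

    Now let [M] be a matching with at most [k / 3] edges. If the rest of the
    graph has no perfect matching, Tutte's theorem, here deduced from Gallai's
    lemma ([deficient_barrier]), gives a set [S] whose deletion leaves at least
    [#|S| + 2] parts without edges between them. If an antipodal pair survives
    there are just two parts and [S] is empty; each part then has at most
    [lambda + 2] vertices, which is too few. Otherwise at most one vertex of
    each pair survives, so [#|S|] is at least [k + 1 - 2 #|M|], and one vertex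
    from each part makes an independent set that is too large
    ([matching_extends]). *)

Set Implicit Arguments.
Unset Strict Implicit.
Unset Printing Implicit Defensive.

Import Order.TTheory GRing.Theory Num.Theory.

(** * Maximum matchings and barriers *)

Section Matchings.
Variables (T : finType) (e : rel T).
Hypothesis e_irr : irreflexive e.
Implicit Types (x y z u v : T) (V W S U : {set T}) (M N : {set {set T}}).

Definition matchings_in V : {set {set {set T}}} :=
  [set M : {set {set T}} | [&& M \subset edges e, trivIset M & cover M \subset V]].

Definition matching_number V := \max_(M in matchings_in V) #|(M : {set {set T}})|.

Definition maximum_matchings V :=
  [set M : {set {set T}} in matchings_in V | #|M| == matching_number V].

Definition missable_together V u v :=
  [exists M : {set {set T}} in maximum_matchings V,
     (u \notin cover M) && (v \notin cover M)].

Lemma edgeP E : reflect (exists x y, e x y /\ E = [set x; y]) (E \in edges e).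
Proof.
apply: (iffP imsetP) => [[[x y]]|[x [y [exy ->]]]].
  by rewrite inE => exy ->; exists x, y.
by exists (x, y); rewrite ?inE.
Qed.

Lemma edge_at E x : E \in edges e -> x \in E ->
  exists2 y, x != y & E = [set x; y].
Proof.
case/edgeP => a [b [eab ->]].
have ab : a != b by apply: contraL eab => /eqP->; rewrite e_irr.
by case/set2P => ->; [exists b | exists a; rewrite 1?eq_sym // setUC].
Qed.

Lemma card_edge E : E \in edges e -> #|E| = 2.
Proof.
case/edgeP => a [b [eab ->]]; rewrite cards2.
by case: eqP eab => // ->; rewrite e_irr.
Qed.

Lemma card_cover_matching M : M \subset edges e -> trivIset M ->
  #|cover M| = 2 * #|M|.
Proof.
move=> /subsetP Me /eqP <-.
rewrite (eq_bigr (fun=> 2)) => [|E /Me]; last exact: card_edge.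
by rewrite sum_nat_const mulnC.
Qed.

Lemma matchings_in_sub V M N :
  M \in matchings_in V -> N \subset M -> N \in matchings_in V.
Proof.
rewrite !inE => /and3P[Me Mt MV] NM.
rewrite (subset_trans NM Me) (trivIsetS NM Mt).
apply/subsetP => x /bigcupP[E EN xE]; apply: (subsetP MV).
by apply/bigcupP; exists E => //; apply: (subsetP NM).
Qed.

Lemma matchings_in_subr V W M :
  M \in matchings_in V -> V \subset W -> M \in matchings_in W.
Proof. by rewrite !inE => /and3P[-> -> MV] /(subset_trans MV) ->. Qed.

Lemma cover_setU1 (E : {set T}) M : cover (E |: M) = E :|: cover M.
Proof. by rewrite /cover bigcup_setU big_set1. Qed.

Lemma matchings_in_add V M E : M \in matchings_in V -> E \in edges e ->
  E \subset V -> [disjoint E & cover M] ->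
  E |: M \in matchings_in V /\ #|E |: M| = #|M|.+1.
Proof.
rewrite !inE => /and3P[Me Mt MV] Ee EV dis.
have [||trEM EM] := @trivIsetU1 _ E M _ Mt.
- by move=> F FM; apply: disjointWr dis; apply: bigcup_sup.
- by apply/negP => /(subsetP Me) /card_edge; rewrite cards0.
by rewrite trEM cover_setU1 !subUset sub1set Ee Me EV MV cardsU1 EM.
Qed.

Lemma leq_matching_number V M :
  M \in matchings_in V -> #|M| <= matching_number V.
Proof. by move=> MV; apply: (@bigop.leq_bigmax_cond _ _ (fun M => #|M|)). Qed.

Lemma maximum_matching_exists V : exists M, M \in maximum_matchings V.
Proof.
have M0 : set0 \in matchings_in V.
  rewrite inE sub0set /cover big_set0 sub0set andbT /=.
  by apply/trivIsetP => A B; rewrite inE.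
have [M MV Mn] := @eq_bigmax_cond _ (mem (matchings_in V))
   (fun M => #|M|) ltac:(by apply/card_gt0P; exists set0).
by exists M; rewrite inE MV /matching_number Mn eqxx.
Qed.

Lemma adjacent_not_missable V x y : x \in V -> y \in V -> e x y ->
  ~~ missable_together V x y.
Proof.
move=> xV yV exy; apply/negP => /existsP[M].
rewrite inE -!andbA => /and4P[MV /eqP Mn xM yM].
have [] := @matchings_in_add V M [set x; y] MV.
- by apply/edgeP; exists x, y.
- by rewrite subUset !sub1set xV.
- rewrite disjoint_subset; apply/subsetP => z.
  by case/set2P => ->.
by move=> /leq_matching_number; lia.
Qed.

Lemma missable_together_sym V u v :
  missable_together V u v = missable_together V v u.
Proof. by apply: eq_existsb => M; rewrite [in X in _ && X]andbC. Qed.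

(** Gallai's lemma. If [u] and [v] are missed by one maximum matching [M] but
    neither pair with [t] is, choose a maximum matching [N] missing [t] that
    shares as many edges as possible with [M]. Then [N] covers [u] and [v], so,
    [M] and [N] having equal size, some [x] other than [t] is covered by [M] and
    missed by [N]. Swapping into [N] the edge of [M] at [x], against the edge of
    [N] that it meets, contradicts the choice of [N]. Hence being equal or not
    missable together is an equivalence relation as soon as every vertex is
    missed by some maximum matching. *)
Lemma missable_together_split V u t v : u \in V -> t \in V -> v \in V ->
  missable_together V t t -> u != v -> missable_together V u v ->
  missable_together V u t || missable_together V t v.
Proof.
move=> uV tV vV /existsP[N0 /and3P[N0V tN0 _]] uneqv uv.
apply: contraLR uv; rewrite negb_or => /andP[ut tv].
apply/negP => /existsP[M /and3P[MV uM vM]].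
pose P N := (N \in maximum_matchings V) && (t \notin cover N).
have PN0 : P N0 by rewrite /P N0V.
have [N /andP[NV tN] Nmax] := arg_maxnP (fun N => #|M :&: N|) PN0.
have uN : u \in cover N.
  by apply: contraR ut => uN; apply/existsP; exists N; apply/and3P.
have vN : v \in cover N.
  by apply: contraR tv => vN; apply/existsP; exists N; apply/and3P.
have tM : t \in cover M.
  by apply: contraR ut => tM; apply/existsP; exists M; apply/and3P.
move: (MV) (NV); rewrite !inE -!andbA.
move=> /and4P[Me Mt McV /eqP Mn] /and4P[Ne Nt NcV /eqP Nn].
have MI : M \in matchings_in V by rewrite inE Me Mt.
have NI : N \in matchings_in V by rewrite inE Ne Nt.
have cardMN : #|cover M :\: cover N| = #|cover N :\: cover M|.
  apply/eqP; rewrite -(eqn_add2l #|cover M :&: cover N|) cardsID setIC cardsID.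
  by rewrite !card_cover_matching // Mn Nn.
have : 1 < #|cover M :\: cover N|.
  rewrite cardMN; apply: leq_trans (_ : #|[set u; v]| <= _).
    by rewrite cards2 uneqv.
  by rewrite subset_leq_card // subUset !sub1set !inE uM vM uN.
rewrite (cardsD1 t) !inE tN tM /= ltnS => /card_gt0P[x].
rewrite !inE => /and3P[xt xN /bigcupP[E EM xE]].
have Ee := subsetP Me _ EM.
have [y xy Exy] := edge_at Ee xE.
have EV : E \subset V by apply: subset_trans McV; apply: bigcup_sup.
have yN : y \in cover N.
  apply/negPn/negP => yN.
  have [] := matchings_in_add NI Ee EV.
    by rewrite disjoint_subset; apply/subsetP => z; rewrite Exy; case/set2P => ->.
  by move=> /leq_matching_number + EN1; rewrite EN1 Nn ltnn.
have /bigcupP[F FN yF] := yN.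
have FM : F \notin M.
  apply/negP => FM; have EF : E = F.
    rewrite -(def_pblock Mt EM (_ : y \in E)) ?Exy ?set22 //.
    exact: def_pblock.
  by case/negP: xN; apply/bigcupP; exists F => //; rewrite -EF.
have EN : E \notin N.
  by apply: contra xN => EN; apply/bigcupP; exists E.
have N1I : N :\ F \in matchings_in V by apply: matchings_in_sub NI (subsetDl _ _).
have yN1 : y \notin cover (N :\ F).
  apply/negP => /bigcupP[G]; rewrite !inE => /andP[GF GN] yG.
  by case/eqP: GF; rewrite -(def_pblock Nt GN yG); apply: def_pblock.
have N1N : cover (N :\ F) \subset cover N.
  apply/subsetP => z /bigcupP[G]; rewrite !inE => /andP[_ GN] zG.
  by apply/bigcupP; exists G.
have [] := matchings_in_add N1I Ee EV.
  rewrite disjoint_subset; apply/subsetP => z; rewrite Exy; case/set2P => -> //.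
  by apply: contra xN; apply: subsetP.
set N' := _ |: _ => N'I N'n.
have PN' : P N'.
  rewrite /P 1!inE N'I N'n /=; apply/andP; split.
    by rewrite -Nn (cardsD1 F N) FN.
  rewrite /N' cover_setU1 !inE negb_or Exy !inE negb_or eq_sym xt /=.
  apply/andP; split; first by apply: contraNneq tN => ->.
  by apply: contra tN; apply: subsetP.
have /= := Nmax _ PN'; rewrite leqNgt => /negP[].
apply: proper_card; apply/properP; split.
  apply/subsetP => G; rewrite !inE => /andP[GM GN]; rewrite GM GN andbT /=.
  by apply/orP; right; apply: contraNneq FM => <-.
by exists E; rewrite !inE EM ?eqxx // (negPf EN) andbF.
Qed.

(** The half of Tutte's theorem used to produce matchings. The labels [f] play
    the role of the components of [V :\: S]: they are the classes of the
    equivalence relation above, for a largest [S] whose deletion lowers the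
    matching number by at least [#|S|]; maximality makes every remaining vertex
    missable.
    The vertices in [U] are those missed by one maximum matching; they have
    distinct labels, and parity turns a positive deficiency into at least 2. *)
Lemma deficient_barrier V : ~~ odd #|V| -> 2 * matching_number V < #|V| ->
  exists S U, exists f : T -> {set T},
  [/\ S \subset V, U \subset V :\: S, #|S| + 2 <= #|U|,
      {in V :\: S &, forall x y, e x y -> f x = f y} & {in U &, injective f}].
Proof.
move=> Veven Vdef.
have Vdef2 : 2 * matching_number V + 2 <= #|V|.
  by rewrite -(even_halfK Veven) -!mul2n in Vdef *; move: Vdef; clear; lia.
pose P (S : {set T}) :=
  (S \subset V) && (matching_number (V :\: S) + #|S| <= matching_number V).
have P0 : P set0 by rewrite /P sub0set setD0 cards0 addn0 leqnn.
have [S /andP[SV Sn] Smax] := arg_maxnP (fun S : {set T} => #|S|) P0.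
set R := V :\: S in Sn.
have Rmiss v : v \in R -> missable_together R v v.
  move=> vR; apply: contraT => nmiss; exfalso.
  have : P (v |: S).
    have [vV vS] : v \in V /\ v \notin S by move: vR; rewrite !inE => /andP[].
    rewrite /P subUset sub1set vV SV cardsU1 vS /=.
    apply: leq_trans Sn; rewrite addnA leq_add2r addn1.
    have [M] := maximum_matching_exists (V :\: (v |: S)).
    rewrite inE => /andP[MI /eqP <-].
    have MR : M \in matchings_in R.
      by apply: matchings_in_subr MI _; apply: setDS; apply: subsetUr.
    have := leq_matching_number MR; rewrite leq_eqVlt => /orP[/eqP Mn|//].
    case/negP: nmiss; apply/existsP; exists M; rewrite andbb inE MR Mn eqxx /=.
    move: MI; rewrite inE => /and3P[_ _ MV]; apply/negP => /(subsetP MV).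
    by rewrite !inE eqxx.
  by move/Smax => /=; move: vR; rewrite inE cardsU1 => /andP[-> _]; rewrite ltnn.
have [M MR] := maximum_matching_exists R.
move: (MR); rewrite !inE -andbA -andbA => /and4P[Me Mt MRc /eqP Mn].
pose joined x y := (x == y) || ~~ missable_together R x y.
have joined_sym : symmetric joined.
  by move=> x y; rewrite /joined eq_sym missable_together_sym.
have joined_trans x y z : x \in R -> y \in R -> z \in R ->
    joined x y -> joined y z -> joined x z.
  move=> xR yR zR; rewrite /joined.
  case: (eqVneq x y) => [->//|xy] /= nxy; case: (eqVneq y z) => [<-|yz] /= nyz.
    by rewrite nxy orbT.
  case: (eqVneq x z) => //= xz; apply/negP => xz'.
  have := missable_together_split xR yR zR (Rmiss _ yR) xz xz'.
  by rewrite (negPf nxy) (negPf nyz).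
exists S, (R :\: cover M), (fun x => [set y in R | joined x y]); split=> //.
- exact: subsetDl.
- have := cardsID (cover M) R; rewrite (setIidPr MRc) card_cover_matching //.
  have := cardsID S V; rewrite (setIidPr SV) -/R.
  by rewrite Mn -/R => RU VS; move: Sn Vdef2 RU VS; clear; lia.
- move=> x y xR yR exy; apply/setP => z; rewrite !inE.
  case zR: (z \in R); move: (zR); rewrite inE => -> //=.
  have jxy : joined x y by rewrite /joined adjacent_not_missable ?orbT.
  by apply/idP/idP; apply: joined_trans; rewrite // joined_sym.
- move=> x y; rewrite !inE => /andP[xM xR] /andP[yM yR] /setP /(_ y).
  rewrite !inE yR /= /joined eqxx /=; case: eqP => //= _ /negP[].
  by apply/existsP; exists M; rewrite MR xM.
Qed.
End Matchings.

(** * Rationality of eigenvalues *)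

Section Spectral.
Local Open Scope ring_scope.

(** The eigenvalues of [C] are 0 and the square roots of [d], so its trace is an
    integer multiple of one of these roots. *)
Lemma trace_cube_scalar n (C : 'M[algC]_n) (d : algC) :
  C *m C *m C = d *: C -> exists m : int, \tr C ^+ 2 = m%:~R ^+ 2 * d.
Proof.
move=> C3; case: (posnP n) => [n0|n_gt0].
  exists 0; rewrite expr0n mul0r /mxtrace big1 ?expr0n // => -[i lt_in].
  by exfalso; move: lt_in; rewrite n0.
have [rs charC] := closed_field_poly_normal (char_poly C).
rewrite (monicP (char_poly_monic C)) scale1r in charC.
have sz : size rs = n.
  by apply/succn_inj; rewrite -(size_prod_XsubC rs id) -charC size_char_poly.
have root_rs a : a \in rs -> exists m : int, a = m%:~R * sqrtC d.
  move=> ars; have : eigenvalue C a.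
    by rewrite eigenvalue_root_char charC root_prod_XsubC.
  case/eigenvalueP => v vC v0.
  have : (v *m C *m C *m C) = d *: (v *m C).
    by rewrite -!mulmxA [C *m (C *m C)]mulmxA C3 scalemxAr.
  rewrite !(vC, =^~ scalemxAl) !scalerA => /eqP.
  rewrite -subr_eq0 -scalerBl scaler_eq0 (negPf v0) orbF => /eqP E.
  have /eqP : a * (a - sqrtC d) * (a + sqrtC d) = 0.
    by rewrite -mulrA -subr_sqr sqrtCK -{}E; ring.
  rewrite !mulf_eq0 -orbA subr_eq0 addr_eq0 => /or3P[] /eqP ->.
  - by exists 0; rewrite mul0r.
  - by exists 1; rewrite mul1r.
  - by exists (-1); rewrite mulN1r.
have [m Em] : exists m : int, \sum_(a <- rs) a = m%:~R * sqrtC d.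
  elim: rs root_rs {charC sz} => [_|a rs IH H].
    by exists 0; rewrite big_nil mul0r.
  have [|m Em] := IH; first by move=> b brs; apply: H; rewrite inE brs orbT.
  have [|m' Em'] := H a; first by rewrite mem_head.
  by exists (m' + m); rewrite big_cons Em Em' intrD mulrDl.
exists m; rewrite -[d]sqrtCK -exprMn -Em.
have := char_poly_trace C n_gt0; rewrite charC -{1}sz coefPn_prod_XsubC ?sz -?lt0n //.
by move/oppr_inj ->.
Qed.

Lemma rational_square_nat (D r s : nat) :
  (0 < r)%N -> (r ^ 2 = s ^ 2 * D)%N -> exists h, D = (h ^ 2)%N.
Proof.
move=> r_gt0 E.
have s_gt0 : (0 < s)%N by case: s E => //; rewrite exp0n //; lia.
have : (s ^ 2 %| r ^ 2)%N by rewrite E dvdn_mulr.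
rewrite dvdn_pexp2r // => /dvdnP[h Er]; exists h.
by apply/eqP; rewrite -(@eqn_pmul2l (s ^ 2)) ?expn_gt0 ?s_gt0 // -E Er expnMn mulnC.
Qed.
End Spectral.

(** * Antipodal double covers of complete graphs *)

Section AntipodalCover.
Variables (T : finType) (e : rel T) (anti : T -> T) (k lambda : nat).
Hypotheses (e_sym : symmetric e) (e_irr : irreflexive e).
Hypothesis antiK : involutive anti.
Hypothesis anti_neq : forall x, anti x != x.
Hypothesis anti_nadj : forall x, e x (anti x) = false.
Hypothesis anti_adj :
  forall x y, y != x -> y != anti x -> e (anti x) y = ~~ e x y.
Hypothesis degree : forall x, #|[set y | e x y]| = k.
Hypothesis lambdaP : is_lambda e lambda.

Local Notation nb x := [set y | e x y].
Local Notation nb3 x y z := #|[set w | [&& e x w, e y w & e z w]]|.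

Lemma anti_inj : injective anti. Proof. exact: inv_inj. Qed.

Lemma anti_adj2 x y : e (anti x) (anti y) = e x y.
Proof.
case: (eqVneq y x) => [->|yx]; first by rewrite !e_irr.
case: (eqVneq y (anti x)) => [->|yx']; first by rewrite antiK e_sym !anti_nadj.
rewrite anti_adj ?(inj_eq anti_inj) //; last first.
  by apply: contraNneq yx' => <-; rewrite antiK.
by rewrite e_sym anti_adj 1?eq_sym ?negbK 1?e_sym // (can2_eq antiK antiK).
Qed.

Lemma adj_antir x y : y != x -> y != anti x -> e x (anti y) = ~~ e x y.
Proof. by move=> yx yx'; rewrite -anti_adj // -anti_adj2 antiK. Qed.

Lemma adj_neq x y : e x y -> y != x.
Proof. by apply: contraTneq => ->; rewrite e_irr. Qed.

Lemma adj_neq_anti x y : e x y -> y != anti x.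
Proof. by apply: contraTneq => ->; rewrite anti_nadj. Qed.

Lemma adj_nadj_antir x y : e x y -> e x (anti y) = false.
Proof. by move=> xy; rewrite adj_antir ?xy ?(adj_neq xy) ?(adj_neq_anti xy). Qed.

(** Each vertex [w] is exactly one of: a neighbour of [z], a neighbour of the
    antipode of [z], [z] itself, the antipode of [z]. All the counts below
    are instances of this. *)
Lemma card_split_antipodes (A : {set T}) z :
  #|A| = #|[set w in A | e z w]| + #|[set w in A | e (anti z) w]|
         + (z \in A) + (anti z \in A).
Proof.
have c1 u : nat_of_bool (u \in A) = #|[set w in A | w == u]|.
  case uA: (u \in A).
    rewrite (_ : [set w in A | w == u] = [set u]) ?cards1 //.
    by apply/setP => w; rewrite !inE andbC; case: eqP => // ->.
  by apply/esym/eqP; rewrite cards_eq0; apply/eqP/setP => w; rewrite !inE andbC;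
     case: eqP => // ->.
have cs (p : pred T) : #|[set w in A | p w]| = \sum_(w in A) p w.
  by rewrite -sum1dep_card big_mkcondr.
rewrite !c1 !cs -!big_split -sum1_card; apply: eq_bigr => w _ /=.
case: (eqVneq w z) => [->|wz]; first
  by rewrite e_irr e_sym anti_nadj eq_sym (negPf (anti_neq _)).
case: (eqVneq w (anti z)) => [->|wz']; first by rewrite e_irr anti_nadj.
by rewrite anti_adj //; case: (e z w).
Qed.

Lemma card_vertices (x0 : T) : #|T| = 2 * (k + 1).
Proof.
have := card_split_antipodes [set: T] x0; rewrite !inE cardsT => ->.
have s z : [set w in [set: T] | e z w] = nb z by apply/setP => w; rewrite !inE.
by rewrite !s !degree; lia.
Qed.

Lemma card_nonadjacent x y : y != x -> y != anti x -> ~~ e x y ->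
  #|common_neighbors e x y| + lambda + 1 = k.
Proof.
move=> yx yx' nxy; have xy' : e x (anti y) by rewrite adj_antir.
have := card_split_antipodes (nb x) y; rewrite degree !inE (negPf nxy) xy'.
have s z : [set w in nb x | e z w] = common_neighbors e x z.
  by apply/setP => w; rewrite !inE.
by rewrite !s (lambdaP xy'); lia.
Qed.

Lemma card_common_split x y z : #|common_neighbors e x y| =
  nb3 x y z + nb3 x y (anti z) + (e x z && e y z) + (e x (anti z) && e y (anti z)).
Proof.
rewrite [LHS](card_split_antipodes _ z) !inE.
by congr (_ + _ + _ + _); apply: eq_card => w; rewrite !inE andbA.
Qed.

Lemma nb3_anti x y z : nb3 (anti x) (anti y) (anti z) = nb3 x y z.
Proof.
rewrite -(card_imset _ anti_inj); apply: eq_card => w.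
apply/imsetP/idP => [[v + ->]|]; rewrite !inE; last first.
  by exists (anti w); rewrite ?antiK // !inE !anti_adj2.
by rewrite -{1}[v]antiK -{2}[v]antiK -{3}[v]antiK !anti_adj2.
Qed.

Lemma nb3C x y z : nb3 x y z = nb3 y x z.
Proof. by apply: eq_card => w; rewrite !inE andbCA. Qed.
Lemma nb3AC x y z : nb3 x y z = nb3 x z y.
Proof. by apply: eq_card => w; rewrite !inE [e y w && _]andbC. Qed.

(** Splitting the common neighbours of [x, y], of [x, z] and of [y, anti z]
    according to the third pair shows that half of the common neighbours of
    [x] and [y] are adjacent to [z]. *)
Lemma lambda_even x y z : e x y -> e x z -> y != z -> ~~ e y z -> ~~ odd lambda.
Proof.
move=> xy xz yz nyz.
have yx : e y x by rewrite e_sym.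
have zx : e z x by rewrite e_sym.
have yx' := adj_nadj_antir yx.
have xz' := adj_nadj_antir xz.
have xy' := adj_nadj_antir xy.
have yz' : e y (anti z).
  by rewrite adj_antir //; [rewrite eq_sym | apply: contraTneq xz => ->; rewrite xy'].
have E1 := card_common_split x y z.
have E2 := card_common_split y (anti z) x.
have E3 := card_common_split x z y.
move: E1 E2 E3; rewrite !lambdaP // xy xz yx yx' xz' xy' (negPf nyz) !andbF !addn0.
rewrite e_sym xz' [e z y]e_sym (negPf nyz) /=.
rewrite -[nb3 y (anti z) (anti x)]nb3_anti !antiK.
rewrite [nb3 y (anti z) x]nb3AC [nb3 y x _]nb3C [nb3 (anti y) _ x]nb3AC.
rewrite [nb3 (anti y) x z]nb3C [nb3 x z y]nb3AC [nb3 x z _]nb3AC.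
by clear; lia.
Qed.

(** By [card_nonadjacent], [k - 1 - lambda] is the number of common neighbours of
    [x] and [anti z]; when [x, y, z] is a triangle, exactly half of them
    are adjacent to [y]. *)
Lemma mu_even x y z : e x y -> e x z -> e y z -> ~~ odd (k - 1 - lambda).
Proof.
move=> xy xz yz.
have zy : e z y by rewrite e_sym.
have E1 := card_common_split x y z.
have E2 := card_common_split x z y.
have E3 := card_common_split y z x.
have := @card_nonadjacent x (anti z).
rewrite (inv_eq antiK) adj_neq_anti // (inj_eq anti_inj) adj_neq // adj_nadj_antir //.
move=> /(_ isT isT isT); rewrite (card_common_split _ _ y).
have zx' : e y x by rewrite e_sym.
have zx : e z x by rewrite e_sym.
move: E1 E2 E3; rewrite !lambdaP // xy xz yz zy zx' zx
  !(adj_nadj_antir xy, adj_nadj_antir xz, adj_nadj_antir yz,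
    adj_nadj_antir zy, adj_nadj_antir zx', adj_nadj_antir zx).
rewrite /= -[nb3 x (anti z) (anti y)]nb3_anti !antiK.
rewrite [nb3 x z _]nb3AC [nb3 x z _]nb3AC [nb3 x (anti z) y]nb3AC.
rewrite [nb3 y z x]nb3AC [nb3 y x z]nb3C [nb3 (anti x) _ _]nb3AC.
rewrite [nb3 y z (anti x)]nb3AC [nb3 y (anti x) z]nb3C.
have -> : e (anti z) y = false by rewrite e_sym adj_nadj_antir.
by clear; lia.
Qed.

Section Matrices.
Local Open Scope ring_scope.
Let n := #|T|.
Let A : 'M[algC]_n := \matrix_(i, j) (e (enum_val i) (enum_val j))%:R.
Let P : 'M[algC]_n := \matrix_(i, j) (enum_val j == anti (enum_val i))%:R.

Lemma sum_enum (F : T -> algC) : \sum_(i < n) F (enum_val i) = \sum_x F x.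
Proof. by rewrite (reindex _ (onW_bij _ (@enum_val_bij T))). Qed.

Lemma mulmx_anti (X : 'M[algC]_n) i j :
  (X *m P) i j = X i (enum_rank (anti (enum_val j))).
Proof.
rewrite mxE (bigD1 (enum_rank (anti (enum_val j)))) //= mxE enum_rankK antiK eqxx.
rewrite mulr1 big1 ?addr0 // => h hj; rewrite mxE (_ : _ == _ = false) ?mulr0 //.
by apply: contraNF hj => /eqP->; rewrite antiK enum_valK.
Qed.

Lemma anti_mx2 : P *m P = 1%:M.
Proof.
apply/matrixP => i j; rewrite mulmx_anti !mxE enum_rankK (inj_eq anti_inj).
by rewrite (inj_eq enum_val_inj) eq_sym.
Qed.

Lemma anti_adj_mxC : P *m A = A *m P.
Proof.
apply/matrixP => i j; rewrite mulmx_anti mxE.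
rewrite (bigD1 (enum_rank (anti (enum_val i)))) //= !mxE enum_rankK eqxx.
rewrite mul1r big1 ?addr0; last first.
  move=> h hi; rewrite mxE (_ : _ == _ = false) ?mul0r //.
  by apply: contraNF hi => /eqP<-; rewrite enum_valK.
by rewrite enum_rankK -[e (anti _) _]anti_adj2 antiK.
Qed.

Lemma adj_mx2 : (1 + lambda < k)%N ->
  A *m A = k%:R%:M + lambda%:R *: A + (k - 1 - lambda)%:R *: (A *m P).
Proof.
move=> lk; apply/matrixP => i j; rewrite mxE !mxE.
transitivity (#|common_neighbors e (enum_val i) (enum_val j)|%:R : algC).
  rewrite -sum1_card natr_sum [RHS]big_mkcond -sum_enum; apply: eq_bigr => h _.
  by rewrite !mxE inE [e (enum_val j) _]e_sym -natrM mulnb; case: andP.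
have := mulmx_anti A i j; rewrite mxE => ->; rewrite mxE enum_rankK.
rewrite -(inj_eq enum_val_inj).
set x := enum_val i; set y := enum_val j.
case: (eqVneq x y) => [<-|xy].
  rewrite e_irr anti_nadj !mulr0 !addr0 mulr1n; congr (_%:R).
  by rewrite -(degree x); apply: eq_card => w; rewrite !inE andbb.
rewrite mulr0n add0r.
case: (eqVneq y (anti x)) => [->|yx'].
  rewrite anti_nadj antiK e_irr !mulr0 addr0.
  rewrite (_ : #|_| = 0%N) //; apply/eqP; rewrite cards_eq0; apply/eqP/setP => w.
  rewrite !inE; case: (boolP (e x w)) => //= xw.
  by rewrite anti_adj ?xw ?(adj_neq xw) ?(adj_neq_anti xw).
rewrite adj_antir // 1?eq_sym //; case: (boolP (e x y)) => exy.
  by rewrite mulr1 mulr0 addr0 lambdaP.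
have := card_nonadjacent _ yx' exy; rewrite eq_sym => /(_ xy) E.
by rewrite mulr0 mulr1 add0r; congr (_%:R); rewrite -E; lia.
Qed.

(** With [d = mu - lambda], the matrix [(2 A + d) (1 - P)] vanishes on vectors
    invariant under the antipodal map, and on the others it squares to
    [4 (d^2 + 4 k)]. Its trace [d * #|T|] is nonzero because [mu > lambda],
    which forces [d^2 + 4 k] to be a square. *)
Lemma discriminant_square : (2 * (1 + lambda) < k)%N -> (0 < #|T|)%N ->
  exists h, ((k - 1 - 2 * lambda) ^ 2 + 4 * k = h ^ 2)%N.
Proof.
move=> lk T_gt0.
have lk' : (1 + lambda < k)%N by move: lk; clear; lia.
pose d : algC := (k - 1 - 2 * lambda)%:R.
have muE : (k - 1 - lambda)%:R = lambda%:R + d :> algC.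
  by rewrite -natrD; congr (_%:R); move: lk; clear; lia.
(* As P (1 - P) = - (1 - P), the factor Q turns the relation for A^2 into a
   quadratic equation in A, whose discriminant is d^2 + 4 k; B completes the
   square. *)
pose Q : 'M[algC]_n := 1%:M - P.
pose B : 'M[algC]_n := 2%:R *: A + d%:M.
have QB : Q *m B = B *m Q.
  rewrite /Q /B mulmxBl mulmxBr mul1mx mulmx1 mulmxDl mulmxDr.
  by rewrite -scalemxAl -scalemxAr anti_adj_mxC mul_scalar_mx mul_mx_scalar.
have QQ : Q *m Q = 2%:R *: Q.
  rewrite {1}/Q mulmxBl mul1mx /Q mulmxBr mulmx1 anti_mx2 opprB.
  by rewrite scaler_nat mulr2n.
have APQ : A *m P *m Q = - (A *m Q).
  by rewrite /Q !mulmxBr !mulmx1 -mulmxA anti_mx2 mulmx1 opprB.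
have AAQ : A *m A *m Q = k%:R *: Q - d *: (A *m Q).
  rewrite adj_mx2 // !mulmxDl -!scalemxAl APQ mul_scalar_mx muE scalerDl.
  by rewrite !scalerN addrA addrK.
have BBQ : B *m B *m Q = (d ^+ 2 + 4%:R * k%:R) *: Q.
  have BQ : B *m Q = 2%:R *: (A *m Q) + d *: Q.
    by rewrite /B mulmxDl -scalemxAl mul_scalar_mx.
  rewrite -mulmxA BQ mulmxDr -!scalemxAr BQ {1}/B mulmxDl -!scalemxAl.
  rewrite mul_scalar_mx mulmxA AAQ.
  generalize (A *m Q) Q => X Y; apply/matrixP => i j; rewrite !mxE; ring.
pose C := B *m Q.
have C3 : C *m C *m C = (4%:R * (d ^+ 2 + 4%:R * k%:R)) *: C.
  have CC : C *m C = (2%:R * (d ^+ 2 + 4%:R * k%:R)) *: Q.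
    by rewrite /C -mulmxA (mulmxA Q) QB -(mulmxA B) QQ -!scalemxAr mulmxA BBQ scalerA.
  rewrite CC -scalemxAl /C mulmxA QB -mulmxA QQ -!scalemxAr scalerA.
  by congr (_ *: _); ring.
have [m trC] := trace_cube_scalar C3.
have trCE : \tr C = d * n%:R.
  have trA : \tr A = 0.
    by rewrite /mxtrace big1 // => i _; rewrite mxE e_irr.
  have trP : \tr P = 0.
    by rewrite /mxtrace big1 // => i _; rewrite mxE eq_sym (negPf (anti_neq _)).
  have trAP : \tr (A *m P) = 0.
    by rewrite /mxtrace big1 // => i _; rewrite mulmx_anti mxE enum_rankK anti_nadj.
  rewrite /C /B mulmxDl -scalemxAl mul_scalar_mx mxtraceD !mxtraceZ.
  rewrite /Q mulmxBr mulmx1 !raddfB /= trA trAP trP mxtrace1.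
  by rewrite !subr0 mulr0 add0r.
apply: (@rational_square_nat _ ((k - 1 - 2 * lambda) * n)%N (2 * `|m|)%N).
  by rewrite muln_gt0 T_gt0 andbT; move: lk; clear; lia.
apply/eqP; rewrite -(eqr_nat algC).
have absm : (`|m|%N%:R : algC) ^+ 2 = m%:~R ^+ 2.
  by rewrite natr_absz intr_norm real_normK // realz.
rewrite !(natrM, natrX, natrD) -/d -trCE trC exprMn absm.
by apply/eqP; ring.
Qed.
End Matrices.

Hypotheses (lambda_gt0 : 0 < lambda) (lambda_lt : 2 * (1 + lambda) < k).

(** [k = 1 + lambda + mu], where [lambda] is even since some vertex has two
    nonadjacent neighbours, and [mu] is even since there is a triangle. *)
Lemma degree_odd (x : T) : odd k.
Proof.
have [y xy] : exists y, e x y.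
  have : 0 < #|nb x| by rewrite degree; move: lambda_lt; clear; lia.
  by case/card_gt0P => y; rewrite inE; exists y.
have [z /andP[xz yz]] : exists z, e x z && e y z.
  have : 0 < #|common_neighbors e x y| by rewrite lambdaP.
  by case/card_gt0P => z; rewrite inE; exists z.
have [w /and3P[xw yw nyw]] : exists w, [&& e x w, y != w & ~~ e y w].
  have : 0 < #|nb x :\: (y |: common_neighbors e x y)|.
    rewrite cardsD degree subn_gt0.
    apply: leq_ltn_trans (subset_leq_card (subsetIr _ _)) _.
    rewrite cardsU1 lambdaP //; move: lambda_lt; clear.
    by case: (_ \notin _) => /=; lia.
  case/card_gt0P => w; rewrite !inE negb_or negb_and => /andP[/andP[wy +] xw].
  by rewrite xw /= => nyw; exists w; rewrite xw eq_sym wy.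
have := lambda_even xy xw yw nyw; have := mu_even xy xz yz.
by move: lambda_lt; clear; lia.
Qed.

(** Writing the square root of [d^2 + 4 k] as [d + 2 g] gives [k = g (d + g)],
    where [g] is an eigenvalue of the graph. It is odd because [k] is, and it is
    not 1 because [lambda] is positive, so [3 (d + 3) <= k]. *)
Lemma eigenvalue_bound (x : T) : 3 * (k - 1 - 2 * lambda) + 9 <= k.
Proof.
have [|h] := discriminant_square lambda_lt; first by apply/card_gt0P; exists x.
move: (degree_odd x) lambda_gt0 lambda_lt; clear; set d := (k - 1 - _).
move=> k_odd l_gt0 kl E.
have dh : d < h by rewrite -ltn_sqr -E; move: kl; clear; lia.
have [g Eg] : exists g, h = d + 2 * g.
  exists (h - d)./2; have : ~~ odd (h - d).
    rewrite oddB ?(ltnW dh) //; have := congr1 odd E.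
    by rewrite oddD !oddX oddM /= addbF => ->; rewrite addbb.
  by move/even_halfK; rewrite -mul2n => ->; rewrite subnKC // ltnW.
have Ek : k = g * (d + g) by move: E; rewrite Eg; clear; nia.
have g_odd : odd g by move: k_odd; rewrite Ek oddM => /andP[].
have g3 : 3 <= g.
  case: g Eg Ek g_odd => [|[|[|g]]] //= _ Ek _; exfalso.
  by move: Ek l_gt0 kl; rewrite /d; clear; lia.
by rewrite [leqRHS]Ek; move: g3; clear; nia.
Qed.

(** A Hoffman-type bound, by double counting. For [q = #|I|] and [d w] the number
    of neighbours of [w] in [I], the squares of [2 * d w - q] are nonnegative,
    and they are known exactly when [w] or its antipode lies in [I]; summing
    over [w] gives, for [p = q - 1] and [D = k - 1 - 2 * lambda],
    [p^2 <= p * D + k], and [3 * D + 9 <= k] concludes. *)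
Lemma independent_set_bound (I : {set T}) :
  {in I &, forall x y, ~~ e x y} -> {in I, forall x, anti x \notin I} ->
  3 * #|I| <= k + 3.
Proof.
move=> Iind Ianti.
case: (set_0Vmem I) => [->|[x0 x0I]]; first by rewrite cards0; lia.
case EI: #|I| => [|[|p]]; [lia|move: lambda_lt; clear; lia|].
have [q Eq] : exists q, q = p.+2 by exists p.+2.
pose mu := k - 1 - lambda.
pose d w := #|[set x in I | e x w]|.
have dE w : d w = \sum_(x in I) e x w.
  by rewrite /d -sum1dep_card big_mkcondr.
have sum_d : \sum_w d w = q * k.
  under eq_bigr => w _ do rewrite dE.
  rewrite exchange_big /= Eq -EI -sum_nat_const; apply: eq_bigr => x xI.
  by rewrite -(degree x) -sum1dep_card [RHS]big_mkcond.
have sum_d2 : \sum_w d w * d w = q * (k + p.+1 * mu).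
  have -> : \sum_w d w * d w = \sum_(x in I) \sum_(y in I) #|common_neighbors e x y|.
    under eq_bigr => w _ do rewrite {1}dE big_distrl /=.
    rewrite exchange_big /=; apply: eq_bigr => x xI.
    under eq_bigr => w _ do rewrite dE big_distrr /=.
    rewrite exchange_big /=; apply: eq_bigr => y yI.
    rewrite -sum1dep_card [RHS]big_mkcond; apply: eq_bigr => w _.
    by rewrite mulnb.
  rewrite Eq -EI -sum_nat_const; apply: eq_bigr => x xI.
  rewrite (bigD1 x) //=; congr (_ + _).
    by rewrite -(degree x); apply: eq_card => w; rewrite !inE andbb.
  rewrite (eq_bigr (fun=> mu)) => [|y /andP[yI yx]].
    rewrite sum_nat_const; congr (_ * _).
    have := EI; rewrite (cardsD1 x) xI => -[<-]; apply: eq_card => y.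
    by rewrite !inE andbC.
  have yx' : y != anti x by apply: contraNneq (Ianti x xI) => <-.
  have := card_nonadjacent yx yx' (Iind x y xI yI).
  by rewrite /mu; clear; lia.
(* The two indicator terms are the value of (2 * d w - q)^2 for w in I, where
   d w = 0, and for the antipodes of I, where d w = p + 1 = q - 1. *)
have step w : 4 * q * d w + ((w \in I) * q ^ 2 + (anti w \in I) * p ^ 2)
    <= 4 * (d w * d w) + q ^ 2.
  case: (boolP (w \in I)) => wI.
    have -> : d w = 0.
      apply/eqP; rewrite cards_eq0; apply/eqP/setP => x; rewrite !inE.
      by case: (boolP (x \in I)) => //= xI; apply/negP/negP; apply: Iind.
    by rewrite (negPf (Ianti w wI)); clear; lia.
  case: (boolP (anti w \in I)) => wI'.
    have -> : d w = p.+1.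
      have := EI; rewrite (cardsD1 (anti w)) wI' => -[<-].
      apply: eq_card => x; rewrite !inE andbC; case: (boolP (x \in I)) => xI; last first.
        by rewrite !andbF.
      rewrite !andbT; case: (eqVneq x (anti w)) => [->|xw] /=.
        by rewrite e_sym anti_nadj.
      have xw' : x != w by apply: contraNneq wI => <-.
      have := Iind _ _ wI' xI; rewrite anti_adj // negbK.
      by rewrite e_sym.
    by rewrite Eq; clear; nia.
  by have [+ _] := nat_Cauchy (2 * d w) q; clear; move: (d w) q => n r; rewrite /=; nia.
have := @leq_sum T (index_enum T) xpredT _ _ (fun w _ => step w).
have cI : \sum_w (w \in I) = q by rewrite Eq -EI -sum1_card [RHS]big_mkcond.
have cI' : \sum_w (anti w \in I) = q.
  by rewrite -cI [RHS](reindex_inj anti_inj).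
have -> : \sum_w (4 * q * d w + ((w \in I) * q ^ 2 + (anti w \in I) * p ^ 2))
    = 4 * q * (q * k) + (q * q ^ 2 + q * p ^ 2).
  by rewrite !big_split /= -big_distrr -!big_distrl /= sum_d cI cI'.
have -> : \sum_w (4 * (d w * d w) + q ^ 2)
    = 4 * (q * (k + p.+1 * mu)) + 2 * (k + 1) * q ^ 2.
  by rewrite big_split /= -big_distrr /= sum_d2 sum_nat_const (card_vertices x0).
have := eigenvalue_bound x0; move: lambda_lt; rewrite /mu Eq; clear.
set D := k - 1 - 2 * lambda => kl dk E.
have mu2 : 2 * (k - 1 - lambda) = k - 1 + D by rewrite /D; move: kl; clear; lia.
have {}E : p.+1 * p.+1 <= p.+1 * D + k.
  have qE : p.+2 * (4 * p.+2 * k + p.+2 ^ 2 + p ^ 2) <=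
      p.+2 * (4 * (k + p.+1 * (k - 1 - lambda)) + p.+2 * (2 * (k + 1))).
    by apply: leq_trans (leq_trans _ E) _; clear; nia.
  move: qE mu2 kl; rewrite leq_pmul2l //.
  move: (k - 1 - lambda) D dk => m D' _; clear.
  case: k => [|k'] //; rewrite subn1 /= => H mE _.
  have : 4 * (p.+1 * m) = 2 * (p.+1 * (k' + D')) by rewrite -mE; ring.
  by move: H; clear; nia.
suff : 3 * p.+1 <= k by clear; lia.
rewrite leqNgt; apply/negP => kp.
have : 3 * (p.+1 * p.+1) <= p.+1 * (k - 9) + 3 * k by move: E dk; clear; nia.
by move: kp dk; clear; nia.
Qed.

(** Otherwise [deficient_barrier] applies to the vertices not covered by [M]. As
    every vertex is adjacent to one of any two antipodes, a surviving
    antipodal pair leaves only two labels; then [S] is empty, each class is too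
    small, being contained in the common neighbourhood of an edge and its
    ends, and the two do not fill the graph. With no surviving pair, at most
    half of the vertices survive, so [S], and with it the independent set
    [U], is too large for [independent_set_bound]. *)
Lemma matching_extends (x0 : T) (M : {set {set T}}) : matching e M ->
  3 * #|M| <= k -> exists2 N, perfect_matching e N & M \subset N.
Proof.
move=> [Me Mt] tk; pose V := ~: cover M.
have cardV : #|V| + 2 * #|M| = 2 * (k + 1).
  rewrite -(card_vertices x0) -(card_cover_matching e_irr Me Mt).
  by rewrite addnC cardsC.
have Veven : ~~ odd #|V|.
  by have := congr1 odd cardV; rewrite oddD !oddM /= addbF => ->.
have [N] := maximum_matching_exists e V.
rewrite !inE => /andP[/and3P[Ne Nt NV] /eqP Nn].
have cardN := card_cover_matching e_irr Ne Nt.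
case: (leqP #|V| (2 * matching_number e V)) => [perf|def].
  have covN : cover N = V by apply/eqP; rewrite eqEcard NV cardN Nn.
  exists (M :|: N); last exact: subsetUl.
  split; last by rewrite /cover bigcup_setU -/(cover M) -/(cover N) covN setUCr.
  split; first by rewrite subUset Me.
  have MN E F : E \in M -> F \in N -> [disjoint E & F].
    move=> EM FN; apply: disjointWl (bigcup_sup E EM) _.
    apply: disjointWr (bigcup_sup F FN) _.
    by rewrite -/(cover M) -/(cover N) covN -setI_eq0 setICr.
  apply/trivIsetP => E F; rewrite !inE => /orP[EM|EN] /orP[FM|FN] EF.
  - exact: (trivIsetP Mt).
  - exact: MN.
  - by rewrite disjoint_sym; apply: MN.
  - exact: (trivIsetP Nt).
exfalso.
have [S [U [f [SV UR cardU fe fU]]]] := deficient_barrier e_irr Veven def.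
set R := V :\: S in UR fe.
have cardR : #|S| + #|R| = #|V|.
  by rewrite -(cardsID S V) (setIidPr SV).
clearbody R.
case: (boolP [exists x in R, anti x \in R]) => [/existsP[x1 /andP[x1R x1R']]|nopair].
  have f_side x u : x \in R -> anti x \in R -> u \in R -> f u = f x \/ f u = f (anti x).
    move=> xR xR' uR; case: (eqVneq u x) => [->|ux]; first by left.
    case: (eqVneq u (anti x)) => [->|ux']; first by right.
    case: (boolP (e x u)) => xu; first by left; rewrite (fe x u).
    by right; rewrite (fe (anti x) u) // anti_adj.
  have cardU2 x : x \in R -> anti x \in R -> #|U| <= 1 + (f x != f (anti x)).
    move=> xR xR'; rewrite addnC addn1 -cards2 -(card_in_imset fU) subset_leq_card //.
    apply/subsetP => _ /imsetP[u uU ->]; rewrite !inE.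
    by have [->|->] := f_side x u xR xR' (subsetP UR u uU); rewrite eqxx ?orbT.
  have f_anti x : x \in R -> anti x \in R -> f x != f (anti x).
    move=> xR xR'; have := cardU2 x xR xR'; case: (_ != _) => //.
    by move: cardU; clear; lia.
  have S0 : #|S| = 0.
    have := cardU2 x1 x1R x1R'; move: cardU; clear; by case: (_ != _) => /=; lia.
  have class_bound x : x \in R -> anti x \in R ->
      #|[set u in R | f u == f x]| <= lambda + 2.
    move=> xR xR'.
    (* As M covers at most 2 k / 3 vertices, more than one antipodal pair avoids
       it; a member y' of a second pair, on the side of x, is adjacent to the
       rest of the class of x, just as x is. *)
    have [y [yR yR' yx yx']] :
        exists y, [/\ y \in R, anti y \in R, y != x & y != anti x].
      have : 0 < #|(R :&: anti @: R) :\: [set x; anti x]|.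
        rewrite cardsD subn_gt0; apply: leq_ltn_trans (subset_leq_card (subsetIr _ _)) _.
        rewrite cards2; have : #|R :|: anti @: R| <= #|T| := max_card _.
        rewrite (card_vertices x0).
        have := cardsUI R (anti @: R); rewrite (card_imset _ anti_inj).
        move: S0 cardR cardV tk lambda_lt; clear.
        by case: (_ != _) => /=; lia.
      case/card_gt0P => y; rewrite !inE negb_or.
      move=> /andP[/andP[yx yx'] /andP[yR /imsetP[z zR Ey]]].
      by exists y; split=> //; rewrite Ey antiK.
    have [y' [yR2 yR2' {}yx {}yx' fy]] : exists y,
        [/\ y \in R, anti y \in R, y != x, y != anti x & f y = f x].
      have [fy|fy] := f_side x y xR xR' yR; first by exists y.
      exists (anti y); rewrite antiK (inv_eq antiK) (inj_eq anti_inj); split=> //.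
      have [//|fy'] := f_side x _ xR xR' yR'.
      by have := f_anti y yR yR'; rewrite fy fy' eqxx.
    have adj z u : z \in R -> anti z \in R -> f z = f x ->
        u \in R -> f u = f x -> u != z -> e z u.
      move=> zR zR' fz uR fu uz; have := f_anti z zR zR'; apply: contraR => nzu.
      case: (eqVneq u (anti z)) => [<-|uz']; first by rewrite fu fz.
      have /(fe _ _ zR' uR) -> : e (anti z) u by rewrite anti_adj.
      by rewrite fu fz.
    have xy' : e x y' by apply: adj.
    rewrite -(lambdaP xy') addnC.
    apply: leq_trans (_ : #|[set x; y'] :|: common_neighbors e x y'| <= _); last first.
      by rewrite cardsU cards2 eq_sym yx leq_subr.
    apply/subset_leq_card/subsetP => u; rewrite !inE => /andP[uR /eqP fu].
    case: (eqVneq u x) => //= ux; case: (eqVneq u y') => //= uy.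
    by rewrite !adj.
  have := class_bound x1 x1R x1R'.
  have := class_bound (anti x1); rewrite antiK => /(_ x1R' x1R).
  have : #|R| <= #|[set u in R | f u == f x1]| + #|[set u in R | f u == f (anti x1)]|.
    apply: leq_trans (leq_card_setU _ _); apply/subset_leq_card/subsetP => u uR.
    by rewrite !inE uR /=; have [->|->] := f_side x1 u x1R x1R' uR; rewrite eqxx ?orbT.
  by move: cardR S0 cardV tk lambda_lt; clear; lia.
have Ranti x : x \in R -> anti x \notin R.
  by move=> xR; apply: contra nopair => xR'; apply/existsP; exists x; rewrite xR.
have cardR2 : 2 * #|R| <= #|T|.
  rewrite mul2n -addnn -{2}(card_imset _ anti_inj) -cardsUI.
  rewrite (_ : R :&: _ = set0) ?cards0 ?addn0 ?max_card //.
  apply/setP => x; rewrite [RHS]inE; apply/negP => /setIP[xR /imsetP[y yR xy]].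
  by have := Ranti y yR; rewrite -xy xR.
have := @independent_set_bound U.
have UI : {in U &, forall x y, ~~ e x y}.
  move=> x y xU yU; apply/negP => xy; have := fe x y (subsetP UR x xU) (subsetP UR y yU) xy.
  by move/(fU _ _ xU yU) => Exy; rewrite Exy e_irr in xy.
move=> /(_ UI); have Uanti : {in U, forall x, anti x \notin U}.
  by move=> x xU; apply: contra (Ranti x (subsetP UR x xU)) => /(subsetP UR).
move=> /(_ Uanti); move: cardR2; rewrite (card_vertices x0).
by move: cardR cardV cardU tk lambda_lt; clear; lia.
Qed.

End AntipodalCover.

(** * Distance in a connected graph *)

Section Distance.
Variables (T : finType) (e : rel T).
Hypotheses (e_sym : symmetric e) (e_irr : irreflexive e).
Hypothesis e_conn : connected_graph e.
Local Notation d := (gdist e).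

Lemma walk_of_lengthP n x y :
  reflect (exists p, [/\ size p = n, path e x p & last x p = y])
          (walk_of_length e n x y).
Proof.
apply: (iffP existsP) => [[p /andP[ep /eqP lp]]|[p [sp ep lp]]].
  by exists p; rewrite size_tuple.
have sp' : size p == n by apply/eqP.
by exists (Tuple sp'); rewrite /= ep lp eqxx.
Qed.

Lemma gdist_le_walk n x y : walk_of_length e n x y -> d x y <= n.
Proof.
move=> w; rewrite leqNgt; apply/negP => lt_n.
have n_lt : n < #|T|.
  by apply: leq_trans lt_n _; rewrite (leq_trans (find_size _ _)) // size_iota.
by have := before_find 0 lt_n; rewrite nth_iota // add0n w.
Qed.

Lemma gdist_walk x y : walk_of_length e (d x y) x y.
Proof.
have : has (fun n => walk_of_length e n x y) (iota 0 #|T|).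
  have /connectP[p ep lp] := e_conn x y.
  case/shortenP: ep lp => q eq uq _ lq.
  apply/hasP; exists (size q); last by apply/walk_of_lengthP; exists q.
  rewrite mem_iota add0n /=.
  by rewrite -[(size q).+1]/(size (x :: q)) -(card_uniqP uq) max_card.
move=> hw; have := nth_find 0 hw; rewrite nth_iota ?add0n //.
by rewrite has_find size_iota in hw.
Qed.

Lemma gdist_adj_le x y z : e y z -> d x z <= (d x y).+1.
Proof.
move=> yz; have /walk_of_lengthP[p [sp ep lp]] := gdist_walk x y.
apply/gdist_le_walk/walk_of_lengthP; exists (rcons p z).
by rewrite size_rcons sp last_rcons rcons_path ep lp.
Qed.

Lemma gdist_last_step n x y : d x y = n.+1 -> exists2 z, e z y & d x z = n.
Proof.
move=> dn; have /walk_of_lengthP[p [sp ep lp]] := gdist_walk x y.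
case/lastP: p sp ep lp => [|p z]; first by rewrite dn.
rewrite size_rcons last_rcons rcons_path dn => -[sp] /andP[ep ez] zy.
rewrite {}zy in ez; exists (last x p) => //; apply/eqP; rewrite eqn_leq.
rewrite gdist_le_walk /=; last by apply/walk_of_lengthP; exists p.
by rewrite -ltnS -dn gdist_adj_le.
Qed.

Lemma gdist_eq0 x y : (d x y == 0) = (x == y).
Proof.
apply/eqP/eqP => [d0|->].
  have /walk_of_lengthP[p [+ _ <-]] := gdist_walk x y.
  by rewrite d0 => /size0nil ->.
by apply/eqP; rewrite -leqn0; apply/gdist_le_walk/walk_of_lengthP; exists [::].
Qed.

Lemma gdist_eq1 x y : (d x y == 1) = e x y.
Proof.
apply/eqP/idP => [/gdist_last_step[z zy /eqP]|xy].
  by rewrite gdist_eq0 => /eqP->.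
apply/eqP; rewrite eqn_leq lt0n gdist_eq0.
rewrite (_ : x != y) ?andbT; last by apply: contraTneq xy => ->; rewrite e_irr.
by apply/gdist_le_walk/walk_of_lengthP; exists [:: y]; rewrite /= xy.
Qed.

Lemma gdist_sym x y : d x y = d y x.
Proof.
suff le u v : d u v <= d v u by apply/eqP; rewrite eqn_leq !le.
have /walk_of_lengthP[p [sp ep lp]] := gdist_walk v u.
apply/gdist_le_walk/walk_of_lengthP; exists (rev (belast v p)).
rewrite size_rev size_belast sp -lp rev_path; split => //.
  by rewrite (eq_path (_ : _ =2 e)).
by case: p {sp ep lp} => [|z p] //=; rewrite rev_cons last_rcons.
Qed.

Lemma gdist_le_diameter x y : d x y <= diameter e.
Proof.
rewrite /diameter; apply: leq_trans (@bigop.leq_bigmax _ (fun x => \max_y d x y) x).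
exact: (@bigop.leq_bigmax _ (fun y => d x y) y).
Qed.

Lemma gdist_attains n : n <= diameter e -> 0 < #|T| -> exists x y, d x y = n.
Proof.
move=> nD T_gt0.
have [x Ex] := @bigop.eq_bigmax _ (fun x => \max_y d x y) T_gt0.
have [y Ey] := @bigop.eq_bigmax _ (fun y => d x y) T_gt0.
exists x; move: nD; rewrite /diameter Ex Ey.
move Em: (d x y) => m {Ex Ey}; elim: m y Em => [|m IH] y dy.
  by rewrite leqn0 => /eqP ->; exists y.
rewrite leq_eqVlt => /orP[/eqP->|nm]; first by exists y.
by have [z _ dz] := gdist_last_step dy; apply: (IH z).
Qed.
End Distance.

(** * Distance-regular graphs with large mu are antipodal covers *)

Section DistanceRegular.
Variables (T : finType) (e : rel T) (b c : nat -> nat).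
Hypotheses (e_sym : symmetric e) (e_irr : irreflexive e).
Hypothesis e_drg : distance_regular e b c.
Hypothesis e_nonbip : ~ bipartite e.
Hypothesis diam_ge3 : 3 <= diameter e.
Hypothesis mu_gt : b 0 < 2 * c 2.
Local Notation d := (gdist e).
Local Notation nb x := [set y | e x y].

Let e_conn : connected_graph e. Proof. by case: e_drg. Qed.
Let e_int := proj2 e_drg.
Let T_gt0 : 0 < #|T|.
Proof.
rewrite lt0n; apply: contraL diam_ge3 => /eqP/card0_eq T0.
by rewrite /diameter big1 // => x; have := T0 x.
Qed.
Let diam2 : 1 <= 2 <= diameter e. Proof. exact: leq_trans diam_ge3. Qed.
Let d_sym := gdist_sym e_sym e_conn.
Let d_eq0 := gdist_eq0 e_conn.
Let d_eq1 := gdist_eq1 e_irr e_conn.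

Lemma d_step x y z : e y z -> d x z <= (d x y).+1 /\ d x y <= (d x z).+1.
Proof. by move=> yz; split; apply: gdist_adj_le; rewrite // e_sym. Qed.

Lemma card_sphere1 x : #|nb x| = b 0.
Proof.
have [_ <-] := e_int (eqP (etrans (d_eq0 x x) (eqxx x))).
  by apply: eq_card => y; rewrite !inE addn1 d_eq1 andbb.
by apply: leq_trans diam_ge3.
Qed.

Lemma card_common2 x y : d x y = 2 -> #|common_neighbors e x y| = c 2.
Proof.
move=> dxy; have [/(_ diam2) <- _] := e_int dxy.
by apply: eq_card => z; rewrite !inE d_eq1 andbC.
Qed.

Lemma big_subsets_meet v (A B : {set T}) : A \subset nb v -> B \subset nb v ->
  b 0 < #|A| + #|B| -> exists2 z, z \in A & z \in B.
Proof.
move=> Av Bv; rewrite -cardsUI -(card_sphere1 v) => AB.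
have : 0 < #|A :&: B|.
  rewrite lt0n; apply: contraL AB => /eqP ->; rewrite addn0 -leqNgt.
  by rewrite subset_leq_card // subUset Av.
by case/card_gt0P => z /setIP[]; exists z.
Qed.

Lemma common_nb1 x y : common_neighbors e x y \subset nb x.
Proof. by apply/subsetP => z; rewrite !inE => /andP[]. Qed.
Lemma common_nb2 x y : common_neighbors e x y \subset nb y.
Proof. by apply/subsetP => z; rewrite !inE => /andP[]. Qed.

Lemma d_le2 u w z : e u w -> e w z -> d u z <= 2.
Proof. by move=> uw /(d_step u)[]; have := d_eq1 u w; rewrite uw => /eqP->. Qed.

(** The hypothesis on [mu] enters here: the neighbours that [v] shares with [u]
    and those that it shares with [z] are each more than half of its
    neighbours. *)
Lemma d2_trans u v z : d u v = 2 -> d v z = 2 -> d u z <= 2.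
Proof.
move=> uv vz; have [|w] := @big_subsets_meet v _ _ (common_nb2 u v) (common_nb1 v z).
  by rewrite !card_common2 // addnn -mul2n.
by rewrite !inE => /andP[uw _] /andP[_ zw]; apply: d_le2 uw _; rewrite e_sym.
Qed.

(** A geodesic of length 4 would consist of two steps of length 2. *)
Lemma gdist_le3 x y : d x y <= 3.
Proof.
rewrite leqNgt; apply/negP => dxy.
have [u [v duv]] : exists u v, d u v = 4.
  by apply: gdist_attains => //; apply: leq_trans (gdist_le_diameter e x y).
have [w1 w1v duw1] := gdist_last_step e_conn duv.
have [w2 w2w1 duw2] := gdist_last_step e_conn duw1.
have dw2v : d w2 v = 2.
  apply/eqP; rewrite eqn_leq (d_le2 w2w1 w1v) /=.
  rewrite ltnNge leq_eqVlt ltnS leqn0 d_eq0 d_eq1; apply/negP => /orP[w2v|/eqP E].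
    by have [] := d_step u w2v; rewrite duv duw2.
  by move: duw2; rewrite E duv.
by have := d2_trans duw2 dw2v; rewrite duv.
Qed.

Lemma card_common1 x y : e x y -> #|common_neighbors e x y| = b 0 - 1 - b 1.
Proof.
move=> xy; have dxy : d x y = 1 by apply/eqP; rewrite d_eq1.
have [_ /(_ (leq_trans (isT : 1 < 3) diam_ge3)) Eb] := e_int dxy.
have := card_sphere1 y; rewrite (cardsD1 x) inE e_sym xy.
rewrite -(cardsID (common_neighbors e x y)) (setIidPr _); last first.
  by apply/subsetP => z; rewrite !inE => /andP[xz ->]; rewrite andbT;
     apply: contraTneq xz => ->; rewrite e_irr.
rewrite (_ : _ :\: _ = [set z | e y z & d x z == 1 + 1]); last first.
  apply/setP => z; rewrite !inE.
  case: (boolP (e y z)) => [yz|]; rewrite ?andbF ?andbT //=.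
  rewrite eq_sym -d_eq0 -d_eq1; have [] := d_step x yz; rewrite dxy.
  by case: (d x z) => [|[|[|m]]].
by rewrite Eb; clear; lia.
Qed.

(** If [u] also were at distance 3 from [z], then by [d2_trans] every neighbour
    of [x] at distance 2 from [z] would be adjacent to [u], whence
    [mu <= lambda]. Then, for [v] next to [x] on a geodesic from [x] to [z], the
    neighbours that [v] shares with [x] and with [z] overlap, which puts [x] and
    [z] at distance 2. *)
Lemma nb_antipode x z u : d x z = 3 -> e x u -> d u z = 2.
Proof.
move=> xz xu; have xuz : 2 <= d u z.
  by have := d_step z xu; rewrite ![d z _]d_sym xz => -[].
have := gdist_le3 u z; rewrite leq_eqVlt => /orP[/eqP uz|]; last first.
  by rewrite ltnS => ?; apply/eqP; rewrite eqn_leq xuz andbT.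
exfalso.
have [y yz xy] := gdist_last_step e_conn xz.
have ux : e u x by rewrite e_sym.
have sub : common_neighbors e x y \subset common_neighbors e x u.
  apply/subsetP => v; rewrite !inE => /andP[xv yv]; rewrite xv /=.
  have vy : e v y by rewrite e_sym.
  have vz : d v z = 2.
    apply/eqP; rewrite eqn_leq (d_le2 vy yz) /=.
    by have := d_step z xv; rewrite ![d z _]d_sym xz => -[].
  case: (boolP (e u v)) => // nuv.
  have uv2 : d u v = 2.
    apply/eqP; rewrite eqn_leq (d_le2 ux xv) /=.
    rewrite ltn_neqAle lt0n d_eq0 eq_sym d_eq1 nuv /=; apply/eqP => E.
    by move: uz; rewrite E vz.
  by have := d2_trans uv2 vz; rewrite uz.
have lam : c 2 <= b 0 - 1 - b 1.
  by rewrite -(card_common1 xu) -(card_common2 xy) subset_leq_card.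
have [v] : exists v, v \in common_neighbors e x y.
  by apply/card_gt0P; rewrite (card_common2 xy); move: mu_gt; clear; lia.
rewrite !inE => /andP[xv yv]; have vy : e v y by rewrite e_sym.
have vz : d v z = 2.
  apply/eqP; rewrite eqn_leq (d_le2 vy yz) /=.
  by have := d_step z xv; rewrite ![d z _]d_sym xz => -[].
have [|w] := @big_subsets_meet v _ _ (common_nb2 x v) (common_nb1 v z).
  by rewrite (card_common2 vz) (card_common1 xv); move: lam mu_gt; clear; lia.
rewrite !inE => /andP[xw _] /andP[_ zw].
by have := @d_le2 x w z xw; rewrite e_sym zw xz => /(_ isT).
Qed.

Lemma b_gt0 i : i < 3 -> 0 < b i.
Proof.
move=> i3; have [x [y dxy]] : exists x y, d x y = i.+1.
  by apply: gdist_attains => //; apply: leq_trans diam_ge3.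
have [z zy dxz] := gdist_last_step e_conn dxy.
have [_ <-] := e_int dxz; last exact: leq_trans diam_ge3.
by apply/card_gt0P; exists y; rewrite !inE zy dxy addn1 eqxx.
Qed.

Lemma sphere_nonempty x i : i <= 3 -> exists y, d x y = i.
Proof.
elim: i => [|i IH] i3; first by exists x; apply/eqP; rewrite d_eq0.
have [y dxy] := IH (ltnW i3).
have := b_gt0 i3; have [_ <-] := e_int dxy; last exact: leq_trans diam_ge3.
by case/card_gt0P => z; rewrite !inE addn1 => /andP[_ /eqP]; exists z.
Qed.

Lemma sphere2_degree x y : d x y = 2 ->
  c 2 + #|[set z | e y z & d x z == 2]| + b 2 = b 0.
Proof.
move=> dxy; have [/(_ diam2) Ec /(_ diam_ge3) Eb] := e_int dxy.
have cs (p : pred T) : #|[set z | e y z & p z]| = \sum_(z in nb y) p z.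
  by rewrite -sum1dep_card -big_mkcondr; apply: eq_bigl => z; rewrite inE.
rewrite -(card_sphere1 y) -Ec -Eb !cs -!big_split -sum1_card.
apply: eq_bigr => z; rewrite inE => yz /=; have [] := d_step x yz; rewrite dxy.
by case: (d x z) => [|[|[|[|m]]]].
Qed.

(** Colour the vertices by the parity of their distance from a fixed one. An edge
    within a sphere of radius 1 gives a triangle, one within a sphere of radius
    2 is excluded by assumption, and one within a sphere of radius 3 by
    [nb_antipode]. *)
Lemma bipartite_of_edgeless_spheres :
  (forall x y z, e x y -> e x z -> e y z -> False) ->
  (forall x y z, d x y = 2 -> e y z -> d x z = 2 -> False) -> bipartite e.
Proof.
move=> no_triangle no_a2; have /card_gt0P[x0 _] := T_gt0.
exists [set w | odd (d x0 w)] => u v uv; rewrite !inE.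
have [v_le u_le] := d_step x0 uv; have vu : e v u by rewrite e_sym.
have := gdist_le3 x0 u; have := gdist_le3 x0 v.
case: (eqVneq (d x0 u) (d x0 v)) => [E|ne] _ _; last first.
  by move: v_le u_le ne; clear; case: (ltngtP (d x0 u) (d x0 v)) => // lt; lia.
exfalso; case Ev: (d x0 v) => [|[|[|[|m]]]].
- move: E => /eqP; rewrite Ev d_eq0 => /eqP E.
  by move/eqP: Ev; rewrite d_eq0 => /eqP E'; rewrite -E -E' e_irr in uv.
- apply: (no_triangle x0 u v) => //; rewrite -d_eq1 ?Ev // E Ev //.
- by apply: (no_a2 x0 v u) => //; rewrite E.
- have : d u x0 = 2 by apply: nb_antipode vu; rewrite d_sym.
  by rewrite d_sym E Ev.
- by have := gdist_le3 x0 v; rewrite Ev.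
Qed.

(** Two such vertices at distance 1 or 3 contradict [nb_antipode] and [d2_trans].
    At distance 2 they show that the number [a_2] of neighbours of [y] at
    distance 2 from [x], for [y] at distance 2 from [x], is zero. But an edge
    [v w] in the neighbourhood of [u] consists of two vertices at distance 2
    from any vertex at distance 3 from [u], so there are no triangles either,
    and the graph is bipartite. *)
Lemma antipode_unique x z1 z2 : d x z1 = 3 -> d x z2 = 3 -> z1 = z2.
Proof.
move=> xz1 xz2; apply/eqP; rewrite -d_eq0.
have z1x : d z1 x = 3 by rewrite d_sym.
have z2x : d z2 x = 3 by rewrite d_sym.
have := gdist_le3 z1 z2; case E: (d z1 z2) => [|[|[|[|m]]]] // _; exfalso.
- have : d z2 x = 2 by apply: nb_antipode z1x _; rewrite -d_eq1 E.
  by rewrite z2x.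
- have a2_0 : b 0 = c 2 + b 2.
    have z21 : d z2 z1 = 2 by rewrite d_sym.
    rewrite -(sphere2_degree z21) (_ : [set z | _ & _] = set0) ?cards0 ?addn0 //.
    apply/setP => p; rewrite !inE; apply/negP => /andP[z1p /eqP z2p].
    have xp : d x p = 2 by rewrite d_sym; apply: nb_antipode z1x z1p.
    by have := d2_trans xp (etrans (d_sym p z2) z2p); rewrite xz2.
  have no_a2 u v w : d u v = 2 -> e v w -> d u w = 2 -> False.
    move=> uv vw uw; have := sphere2_degree uv; rewrite a2_0.
    rewrite (cardsD1 w) !inE vw uw eqxx; clear; lia.
  apply: e_nonbip; apply: bipartite_of_edgeless_spheres => // u v w uv uw vw.
  have [z uz] := sphere_nonempty u (leqnn 3).
  apply: (no_a2 z v w) => //; rewrite d_sym.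
    exact: nb_antipode uz uv.
  exact: nb_antipode uz uw.
- have [u xu] := sphere_nonempty x (isT : 1 <= 3).
  have {}xu : e x u by rewrite -d_eq1 xu.
  have uz1 : d z1 u = 2 by rewrite d_sym; apply: nb_antipode xz1 xu.
  have uz2 := nb_antipode xz2 xu.
  by have := d2_trans uz1 uz2; rewrite E.
Qed.

(** The default value is never taken: every vertex has a vertex at distance 3. *)
Definition antipode x := odflt x [pick z | d x z == 3].

Lemma gdist_antipode x : d x (antipode x) = 3.
Proof.
rewrite /antipode; case: pickP => [z /eqP //|no].
by have [z /eqP] := sphere_nonempty x (leqnn 3); rewrite no.
Qed.

Lemma antipodeP x z : d x z = 3 -> z = antipode x.
Proof. by move=> xz; apply: antipode_unique xz (gdist_antipode x). Qed.

Lemma antipodeK : involutive antipode.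
Proof. by move=> x; apply/esym/antipodeP; rewrite d_sym gdist_antipode. Qed.

Lemma antipode_neq x : antipode x != x.
Proof. by rewrite eq_sym -d_eq0 gdist_antipode. Qed.

Lemma antipode_nadj x : e x (antipode x) = false.
Proof. by rewrite -d_eq1 gdist_antipode. Qed.

Lemma antipode_adj x y : y != x -> y != antipode x ->
  e (antipode x) y = ~~ e x y.
Proof.
move=> yx yx'; case: (boolP (e x y)) => xy.
  by rewrite e_sym -d_eq1 (nb_antipode (gdist_antipode x) xy).
have xy2 : d x y = 2.
  have := gdist_le3 x y; case E: (d x y) => [|[|[|[|m]]]] // _.
  - by move/eqP: E; rewrite d_eq0 eq_sym (negPf yx).
  - by move/eqP: E; rewrite d_eq1 (negPf xy).
  - by move/antipodeP: E yx' => ->; rewrite eqxx.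
rewrite -d_eq1 d_sym; have := gdist_le3 y (antipode x).
case E: (d y (antipode x)) => [|[|[|[|m]]]] // _; exfalso.
- by move/eqP: E; rewrite d_eq0 (negPf yx').
- by have := d2_trans xy2 E; rewrite gdist_antipode.
- by move: E yx; rewrite d_sym => /antipodeP ->; rewrite antipodeK eqxx.
Qed.

(** Vertices at distance 2 from [x] are neighbours of the antipode of [x], so
    without triangles no two of them are adjacent. *)
Lemma triangle_exists : exists x y z, [/\ e x y, e x z & e y z].
Proof.
case: (boolP [exists x, exists y, exists z, [&& e x y, e x z & e y z]]).
  by case/existsP => x /existsP[y /existsP[z /and3P[]]]; exists x, y, z.
move=> no; have no_triangle x y z : e x y -> e x z -> e y z -> False.
  move=> xy xz yz; case/negP: no; apply/existsP; exists x; apply/existsP; exists y.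
  by apply/existsP; exists z; rewrite xy xz.
case: e_nonbip; apply: bipartite_of_edgeless_spheres => // x y z xy yz xz.
have far u : d x u = 2 -> e (antipode x) u.
  move=> xu; rewrite antipode_adj -?d_eq1 ?xu //.
    by rewrite eq_sym -d_eq0 xu.
  by apply: contra_eqN xu => /eqP ->; rewrite gdist_antipode.
exact: no_triangle (far y xy) (far z xz) yz.
Qed.
End DistanceRegular.

Theorem theorem3p16 (T : finType) (e : rel T)
    (e_sym : symmetric e) (e_irr : irreflexive e)
    (b c : nat -> nat) (k mu : nat)
    (e_drg : distance_regular e b c)
    (k_def : k = b 0) (mu_def : mu = c 2)
    (e_nonbip : ~ bipartite e)
    (diam_ge3 : 3 <= diameter e)
    (mu_gt : k < 2 * mu) :
  (exists2 lambda, is_lambda e lambda & 1 <= lambda) /\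
  extendable e (k %/ 3).
Proof.
subst k mu; pose lambda := b 0 - 1 - b 1.
have deg := card_sphere1 e_irr e_drg diam_ge3.
have lamP : is_lambda e lambda.
  by move=> x y; apply: (card_common1 e_sym e_irr e_drg diam_ge3).
have antiK := antipodeK e_sym e_irr e_drg e_nonbip diam_ge3 mu_gt.
have anti_neq := antipode_neq e_drg diam_ge3.
have anti_nadj := antipode_nadj e_irr e_drg diam_ge3.
have anti_adj := antipode_adj e_sym e_irr e_drg e_nonbip diam_ge3 mu_gt.
have [x [y [z [xy xz yz]]]] :=
  triangle_exists e_sym e_irr e_drg e_nonbip diam_ge3 mu_gt.
have lambda_gt0 : 0 < lambda.
  by rewrite -(lamP x y xy); apply/card_gt0P; exists z; rewrite inE xz.
have lambda_lt : 2 * (1 + lambda) < b 0.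
  have [w xw] := sphere_nonempty e_drg diam_ge3 x (isT : 2 <= 3).
  have e_conn : connected_graph e by case: e_drg.
  have wx : w != x by rewrite eq_sym -(gdist_eq0 e_conn) xw.
  have wx' : w != antipode e x.
    by apply: contra_eqN xw => /eqP ->; rewrite (gdist_antipode e_drg).
  have nxw : ~~ e x w by rewrite -(gdist_eq1 e_irr e_conn) xw.
  have := card_nonadjacent e_sym e_irr antiK anti_neq anti_nadj anti_adj
            deg lamP wx wx' nxw.
  by rewrite (card_common2 e_irr e_drg) //; move: mu_gt; clear; lia.
have extends M : matching e M -> 3 * #|M| <= b 0 ->
    exists2 N, perfect_matching e N & M \subset N.
  exact: (matching_extends e_sym e_irr antiK anti_neq anti_nadj anti_adj deg
           lamP lambda_gt0 lambda_lt x).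
have cardT := card_vertices e_sym e_irr anti_neq anti_nadj anti_adj deg x.
split; first by exists lambda.
split; first by case: e_drg.
- by rewrite cardT mul2n odd_double.
- have [||N perfN _] := extends set0; last by exists N.
    by split; [apply: sub0set | apply/trivIsetP => A B; rewrite inE].
  by rewrite cards0.
- by rewrite cardT; move: lambda_lt; clear; lia.
- move=> M matM cardM; apply: extends => //.
  by rewrite cardM mulnC leq_trunc_div.
Qed.
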